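(* Let $\mathbb X=(\mathbb X_t)_{t\ge0}$ be a Hunt process on $\mathbb D=\mathbb N_0\times D$ with transition semigroup $\mathbb K$ and infinite lifetime, and write $\mathbb X_t=(N_t,X_t)$ with $N_t\in\mathbb N_0$ and $X_t\in D$. Then: (a) The process $N=(N_t,t\ge0)$ is almost surely increasing (i.e. nondecreasing), integer-valued and càdlàg. (b) The process $X=(X_t,t\ge0)$ is a Hunt process (on $D$) with transition semigroup $K$.
   Context: Setting. Let $d\in\mathbb N$, $\alpha\in(0,2)$, and let $D\subset\mathbb R^d$ be a nonempty bounded open Lipschitz set; $D^c=\mathbb R^d\setminus D$, $\mathbb N_0=\{0,1,2,\dots\}$. All sets, functions, measures and kernels are Borel. $Y=(Y_t)_{t\ge0}$ is the isotropic $\alpha$-stable Lévy process in $\mathbb R^d$ (characteristic function $e^{-t|\xi|^\alpha}$), with Lévy kernel density $\nu(x,z)=c_{d,\alpha}|x-z|^{-d-\alpha}$, $c_{d,\alpha}=\frac{2^\alpha\Gamma((d+\alpha)/2)}{\pi^{d/2}|\Gamma(-\alpha/2)|}$; $\mathbf P^x$ is its law started at $x$. $\tau_D=\inf\{t>0:Y_t\notin D\}$. $p_D(t,x,y)$ ($t>0$, $x,y\in D$) is the Dirichlet heat kernel of $D$, i.e. the jointly continuous density with $\mathbf P^x(Y_t\in A,\,t<\tau_D)=\int_A p_D(t,x,y)\,dy$ for $A\subset D$. Reflection kernel. $\mu$ is a Markov kernel from $D^c$ to $D$: $z\mapsto\mu(z,A)$ is Borel on $D^c$ for every Borel $A\subset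 D$, and $\mu(z,\cdot)$ is a probability measure on $D$ for every $z\in D^c$. Moreover there is a compact $H\subset D$ with $\vartheta:=\inf_{z\in D^c}\mu(z,H)>0$. Put $\nu\mathbf 1_{D^c}\mu(v,B)=\int_{D^c}\nu(v,z)\mu(z,B)\,dz$ for $v\in D$, $B\subset D$. Semigroup $K$. Let $k_0=p_D$ and, for $n\in\mathbb N_0$, $k_{n+1}(t,x,y)=\int_0^t ds\int_D dv\int_D p_D(s,x,v)\,\nu\mathbf 1_{D^c}\mu(v,dw)\,k_n(t-s,w,y)$; $k=\sum_{n\ge0}k_n$. Let $K_n(t)f(x)=\int_D k_n(t,x,y)f(y)\,dy$ and $K(t)f(x)=\int_D k(t,x,y)f(y)\,dy$. (It is known that $K=(K(t))_{t>0}$ is a semigroup and $\int_D k(t,x,y)\,dy=1$.) Ladder semigroup. $\mathbb D=\mathbb N_0\times D$ with the product topology. For bounded Borel $\mathbf f$ on $\mathbb D$ with components $f_n(x)=\mathbf f(n,x)$, $\mathbb K(t)\mathbf f(m,x)=\sum_{n=m}^\infty K_{n-m}(t)f_n(x)$, $t>0$, $m\in\mathbb N_0$, $x\in D$; $\mathbb K=(\mathbb K(t))_{t>0}$ is a Markovian semigroup. A Hunt process is a càdlàg, quasi-left continuous strong Markov process with a right-continuous filtration. $\mathbb P^{(m,x)}$ denotes the law of $\mathbb X$ started at $(m,x)\in\mathbb D$ (''almost surely'' is with respect to every such law), and $\mathbb P^x=\mathbb P^{(0,x)}$. *)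

(* Defs.v *)
From HB Require Import structures.
From mathcomp Require Import all_boot all_order all_algebra.
From mathcomp Require Import all_classical all_reals all_analysis.
From mathcomp Require Import measurable_realfun.

Set Implicit Arguments.
Unset Strict Implicit.
Unset Printing Implicit Defensive.

Import Order.TTheory GRing.Theory Num.Theory.
Import numFieldNormedType.Exports.

Local Open Scope classical_set_scope.
Local Open Scope ring_scope.

(** The library does not join these two structures on products. *)
HB.instance Definition _ (S1 S2 : ptopologicalType) :=
  Pointed.on (S1 * S2)%type.

Notation borel S := (g_sigma_algebraType (@open S)).
Notation Rd R d := (borel 'rV[R]_d).

Section borel_rV.
Context {R : realType}.

Lemma measurable_open (S : ptopologicalType) (U : set S) :
  open U -> measurable (U : set (borel S)).
Proof. exact: sub_sigma_algebra. Qed.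

Lemma measurable_fun_continuous (S : ptopologicalType) (f : S -> R) :
  continuous f -> measurable_fun [set: borel S] (f : borel S -> R).
Proof.
move=> cf; apply: (measurability (@RGenOInfty.G R)).
  exact: RGenOInfty.measurableE.
move=> _ [_ [x ->] <-]; rewrite setTI; apply: measurable_open.
by move/continuousP : cf; apply; exact: interval_open.
Qed.

Definition rat_box d (q : 'rV[rat]_d * nat) : set 'rV[R]_d :=
  [set v | forall i, `|ratr (q.1 0 i) - v 0 i| < q.2.+1%:R^-1].

Lemma open_rat_box d (U : set 'rV[R]_d) : open U ->
  U = \bigcup_q (if `[< rat_box q `<=` U >] then rat_box q else set0).
Proof.
move=> oU; apply/seteqP; split => [v Uv|v [q _]]; last first.
  by case: asboolP => // qU /qU.
have [e /= e0 eU] : exists2 e : R, 0 < e & ball v e `<=` U.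
  by apply/nbhs_ballP; move: oU; rewrite openE => /(_ _ Uv).
have [k _ /(_ k (leqnn k)) /= ke] :=
  near_infty_natSinv_lt (PosNum (divr_gt0 e0 (ltr0n _ 2))).
have k0 : 0 < k.+1%:R^-1 :> R by rewrite invr_gt0 ltr0n.
have /choice[q qP] (i : 'I_d) :
    exists q : rat, `|ratr q - v 0 i| < k.+1%:R^-1 :> R.
  have /rat_in_itvoo[q] : v 0 i - k.+1%:R^-1 < v 0 i + k.+1%:R^-1.
    by rewrite ltrBlDr -addrA ltrDl addr_gt0.
  by rewrite in_itv /= -ltr_distl => ?; exists q.
exists (\row_i q i, k) => //; case: asboolP => [_ i|].
  by rewrite mxE; exact: qP.
case=> w qw; apply: eU; split => // i j; rewrite (ord1 i) /ball /=.
have := qw j; rewrite mxE /= => qwj.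
rewrite -[v 0 j - w 0 j](subrKA (ratr (q j))).
apply: le_lt_trans (ler_normD _ _) _.
rewrite (splitr e) ltrD//; last exact: lt_trans ke.
by rewrite distrC; exact: lt_trans ke.
Qed.

Definition row_cons d (u : measurableTypeR R * Rd R d) : Rd R d.+1 :=
  row_mx ((u.1)%:M : 'M[R]_1) (u.2 : 'rV_d).

Definition row_uncons d (v : Rd R d.+1) : measurableTypeR R * Rd R d :=
  (v 0 0, \row_(i < d) (v : 'rV_d.+1) 0 (lift ord0 i)).

Lemma row_consE0 d (u : measurableTypeR R * Rd R d) :
  (row_cons u : 'rV_d.+1) 0 0 = u.1.
Proof.
by rewrite [LHS]mxE; case: splitP => // j _; rewrite mxE (ord1 j) mulr1n.
Qed.

Lemma row_consES d (u : measurableTypeR R * Rd R d) i :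
  (row_cons u : 'rV_d.+1) 0 (lift ord0 i) = (u.2 : 'rV_d) 0 i.
Proof.
rewrite [LHS]mxE; case: splitP => [[[]]//|j]; rewrite /= /bump leq0n add1n.
by move=> [ij]; congr (_ _ _); exact/val_inj.
Qed.

Lemma row_consK d : cancel (@row_cons d) (@row_uncons d).
Proof.
move=> [x v]; rewrite /row_uncons row_consE0; congr pair.
by apply/rowP => i; rewrite mxE row_consES.
Qed.

Lemma measurable_row_cons d : measurable_fun setT (@row_cons d).
Proof.
apply: (@measurability _ _ _ (Rd R d.+1) _ _ (@open 'rV[R]_d.+1)) => // _ [U oU <-]; rewrite setTI.
rewrite (open_rat_box oU) preimage_bigcup.
apply: countable_bigcupT_measurable => // q.
case: asboolP => _; last by rewrite preimage_set0.
pose q' : 'rV[rat]_d * nat := (\row_i q.1 0 (lift ord0 i), q.2).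
rewrite (_ : _ @^-1` _ = ball (ratr (q.1 0 0) : R) (q.2.+1%:R^-1 : R) `*`
    (rat_box q' : set (Rd R d))); last first.
  apply/seteqP; split=> [[x v] /= H|[x v] /= [H1 H2] i].
    split => [|i]; first by have := H 0; rewrite row_consE0.
    by have := H (lift ord0 i); rewrite row_consES mxE.
  case: (unliftP ord0 i) => [j|] ->.
    by have := H2 j; rewrite row_consES mxE.
  by rewrite row_consE0.
apply: measurableX; first exact: measurable_ball.
rewrite (_ : rat_box q' = \bigcap_i [set v : 'rV[R]_d |
   `|ratr (q'.1 0 i) - v 0 i| < q'.2.+1%:R^-1]); last first.
  by apply/seteqP; split=> v /= H i; [move=> _|]; exact: H.
apply: fin_bigcap_measurable => // i _; apply: measurable_open.
rewrite (_ : [set _ | _] = (fun v : 'rV[R]_d => v 0 i) @^-1`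
  ball (ratr (q'.1 0 i) : R) q'.2.+1%:R^-1)//.
by apply: open_comp; [move=> v _; exact: coord_continuous|exact: ball_open].
Qed.

Lemma measurable_row_uncons d : measurable_fun setT (@row_uncons d).
Proof.
apply/measurable_fun_pairP; split.
  by apply: measurable_fun_continuous; exact: coord_continuous.
apply: (@measurability _ _ _ (Rd R d) _ _ (@open 'rV[R]_d)) => // _ [U oU <-]; rewrite setTI.
apply: measurable_open; apply: open_comp => // v _.
move=> A /nbhs_ballP[e /= e0 eA]; apply/nbhs_ballP; exists e => // w [_ vw].
by apply: eA; split=> // i j; rewrite !mxE; exact: vw.
Qed.

Section step.
Context d (m : {sigma_finite_measure set (Rd R d) -> \bar R}).
Local Open Scope ereal_scope.

Definition lebesgue_rV_step : set (Rd R d.+1) -> \bar R :=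
  pushforward (@lebesgue_measure R \x m) (@row_cons d).

Let step0 : lebesgue_rV_step set0 = 0.
Proof. by rewrite /lebesgue_rV_step /pushforward preimage_set0 measure0. Qed.

Let step_ge0 A : 0 <= lebesgue_rV_step A.
Proof. by rewrite /lebesgue_rV_step /pushforward measure_ge0. Qed.

Let step_sigma_additive : semi_sigma_additive lebesgue_rV_step.
Proof.
have mp A : measurable A -> measurable (@row_cons d @^-1` A).
  by move=> mA; rewrite -[X in measurable X]setTI; exact: measurable_row_cons.
move=> F mF tF mUF; rewrite /lebesgue_rV_step /pushforward preimage_bigcup.
apply: measure_semi_sigma_additive.
- by move=> n; exact: mp.
- apply/trivIsetP => /= i j _ _ ij; rewrite -preimage_setI.
  by move/trivIsetP : tF => /(_ _ _ _ _ ij) ->//; rewrite preimage_set0.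
- by rewrite -preimage_bigcup; exact: mp.
Qed.

HB.instance Definition _ := isMeasure.Build _ _ _ lebesgue_rV_step
  step0 step_ge0 step_sigma_additive.

Let step_sigma_finite : sigma_finite setT lebesgue_rV_step.
Proof.
have /sigma_finiteP[F [TF ndF Foo]] := sigma_finiteT (@lebesgue_measure R).
have /sigma_finiteP[G [TG ndG Goo]] := sigma_finiteT m.
exists (fun k => @row_uncons d @^-1` (F k `*` G k)).
  rewrite -preimage_bigcup (_ : \bigcup_k (F k `*` G k) = setT)//.
  rewrite -setXTT TF TG; apply/seteqP; split => -[x y].
    by move=> [k _ [/= Fx Gy]]; split; exists k.
  move=> [/= [k _ Fx] [l _ Gy]]; exists (maxn k l) => //; split.
    by move: x Fx; exact/subsetPset/ndF/leq_maxl.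
  by move: y Gy; exact/subsetPset/ndG/leq_maxr.
move=> k; have [mF Fk] := Foo k; have [mG Gk] := Goo k; split.
  rewrite -[X in measurable X]setTI; apply: measurable_row_uncons => //.
  exact: measurableX.
rewrite /lebesgue_rV_step /pushforward -comp_preimage.
rewrite (_ : _ \o _ = id); last by apply/funext => u; exact: row_consK.
by rewrite product_measure1E// lte_mul_pinfty// ge0_fin_numE.
Qed.

HB.instance Definition _ := Measure_isSigmaFinite.Build _ _ _ lebesgue_rV_step
  step_sigma_finite.

End step.

(** Iterated product of [lebesgue_measure], transported to row vectors. *)
Fixpoint lebesgue_rV d : {sigma_finite_measure set (Rd R d) -> \bar R} :=
  match d with
  | 0 => \d_((0 : 'rV[R]_0) : Rd R 0)
  | d'.+1 => lebesgue_rV_step (lebesgue_rV d')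
  end.

End borel_rV.

Section stable.
Context {R : realType}.

Definition dotr d (x y : 'rV[R]_d) : R := \sum_i x 0 i * y 0 i.

(** The library norm on ['rV_d] is the sup norm. *)
Definition enorm d (x : 'rV[R]_d) : R := Num.sqrt (dotr x x).

(** Near each boundary point [D] is the region above the graph of a Lipschitz
    function in some orthonormal coordinates: the last coordinate is
    [dotr y e], and [g] only sees the projection [y - (dotr y e) *: e] of [y]
    to the hyperplane orthogonal to [e]. *)
Definition lipschitz_set d (D : set 'rV[R]_d) : Prop :=
  forall z, (closure D `\` interior D) z ->
  exists (e : 'rV[R]_d) (g : 'rV[R]_d -> R) (L r : R),
    [/\ enorm e = 1, 0 < r,
        forall u v, `|g u - g v| <= L * enorm (u - v)
      & forall y, enorm (y - z) < r ->
          (D y <-> g (y - (dotr y e) *: e) < dotr y e)].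

(** Gauss' product, which represents the Gamma function off the poles
    [0, -1, -2, ...]. *)
Definition Gamma (x : R) : R :=
  lim (n`!%:R * n%:R `^ x / \prod_(k < n.+1) (x + k%:R) @[n --> \oo]).

Definition stable_const (d : nat) (alpha : R) : R :=
  2 `^ alpha * Gamma ((d%:R + alpha) / 2) /
  (pi `^ (d%:R / 2) * `|Gamma (- (alpha / 2))|).

Definition nu d (alpha : R) (x z : 'rV[R]_d) : R :=
  stable_const d alpha * enorm (x - z) `^ (- d%:R - alpha).

Definition cadlag (S : topologicalType) (E : set S) (g : R -> S) : Prop :=
  (forall t, 0 <= t -> g s @[s --> t^'+] --> g t) /\
  (forall t, 0 < t -> exists2 l, E l & g s @[s --> t^'-] --> l).

Section process.
Context dO (O : measurableType dO) (Q : probability O R) (d : nat).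
Variable Y : R -> O -> 'rV[R]_d.

Record levy_process : Prop := LevyProcess {
  levy_measurable : forall t, 0 <= t ->
    measurable_fun setT (Y t : O -> Rd R d);
  levy_start : {ae Q, forall w, Y 0 w = 0};
  levy_independent : forall (n : nat) (t : nat -> R) (B : nat -> set (Rd R d)),
    0 <= t 0%N -> (forall i, t i <= t i.+1) ->
    (forall i, measurable (B i)) ->
    fine (Q (\bigcap_(i in [set i | (i < n)%N])
              [set w | B i (Y (t i.+1) w - Y (t i) w)])) =
    \prod_(i < n) fine (Q [set w | B i (Y (t i.+1) w - Y (t i) w)]);
  levy_stationary : forall s t (B : set (Rd R d)), 0 <= s -> 0 <= t ->
    measurable B ->
    Q [set w | B (Y (s + t) w - Y s w)] = Q [set w | B (Y t w)];
  levy_cadlag : {ae Q, forall w, cadlag setT (Y ^~ w)} }.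

(** The characteristic function of [Y t] is [exp (- t |xi|^alpha)], split into
    real and imaginary parts. *)
Definition isotropic_stable (alpha : R) : Prop :=
  levy_process /\
  forall t (xi : 'rV[R]_d), 0 <= t ->
    (\int[Q]_w (cos (dotr xi (Y t w)))%:E =
      (expR (- t * enorm xi `^ alpha))%:E /\
     \int[Q]_w (sin (dotr xi (Y t w)))%:E = 0)%E.

(** [Y] starts at [0], so the law of the process started at [x] is that of
    [x + Y]. *)
Definition exit_time (D : set 'rV[R]_d) (x : 'rV[R]_d) (w : O) : \bar R :=
  ereal_inf [set t%:E | t in [set t | 0 < t /\ ~ D (x + Y t w)]].

Definition dirichlet_heat_kernel (D : set 'rV[R]_d)
    (p : R -> 'rV[R]_d -> 'rV[R]_d -> R) : Prop :=
  [/\ forall t x y, 0 < t -> D x -> D y -> 0 <= p t x y,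
      {within [set u : R * 'rV[R]_d * 'rV[R]_d |
                [/\ 0 < u.1.1, D u.1.2 & D u.2]],
        continuous (fun u => p u.1.1 u.1.2 u.2)}
    & forall t x (A : set (Rd R d)), 0 < t -> D x -> measurable A ->
        A `<=` D ->
        Q [set w | A (x + Y t w) /\ (t%:E < exit_time D x w)%E] =
        (\int[lebesgue_rV d]_(y in A) (p t x y)%:E)%E].

End process.

End stable.

Section semigroups.
Context {R : realType} (d : nat) (alpha : R) (D : set 'rV[R]_d).
Variables (p : R -> 'rV[R]_d -> 'rV[R]_d -> R).
Variables (mu : R.-pker (Rd R d) ~> (Rd R d)).
Local Open Scope ereal_scope.

(** Only the values [mu z] with [z] outside [D] are used.  This is a measure
    in [B] when [D] is measurable, and is integrated against in [kn]. *)
Definition nu_mu (v : 'rV[R]_d) (B : set (Rd R d)) : \bar R :=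
  \int[lebesgue_rV d]_(z in ~` D) ((nu alpha v z)%:E * mu z B).

Fixpoint kn (n : nat) (t : R) (x y : 'rV[R]_d) : \bar R :=
  match n with
  | 0 => (p t x y)%:E
  | n'.+1 =>
    \int[lebesgue_measure]_(s in `]0%R, t[)
      \int[lebesgue_rV d]_(v in D)
        \int[nu_mu v]_(w in D) ((p s x v)%:E * kn n' (t - s)%R w y)
  end.

Definition ksum (t : R) (x y : 'rV[R]_d) : \bar R :=
  \sum_(0 <= n <oo) kn n t x y.

Definition Kn (n : nat) (t : R) (f : 'rV[R]_d -> \bar R) (x : 'rV[R]_d) :=
  \int[lebesgue_rV d]_(y in D) (kn n t x y * f y).

Definition K (t : R) (f : 'rV[R]_d -> \bar R) (x : 'rV[R]_d) : \bar R :=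
  \int[lebesgue_rV d]_(y in D) (ksum t x y * f y).

Definition ladder : set (nat * 'rV[R]_d) := setT `*` D.

Definition ladderK (t : R) (f : nat * 'rV[R]_d -> \bar R)
    (z : nat * 'rV[R]_d) : \bar R :=
  \sum_(z.1 <= n <oo) Kn (n - z.1) t (fun y => f (n, y)) z.2.

End semigroups.

Section hunt.
Context {R : realType} (S : ptopologicalType) (E : set S).
Local Open Scope ereal_scope.

Definition bounded_borel (f : S -> \bar R) : Prop :=
  measurable_fun (E : set (borel S)) (f : borel S -> \bar R) /\
  exists M : R, forall x, E x -> `|f x| <= M%:E.

Record markov_semigroup (T : R -> (S -> \bar R) -> S -> \bar R) : Prop :=
  MarkovSemigroup {
  semigroup_bounded : forall t f, (0 < t)%R -> bounded_borel f ->
    bounded_borel (T t f);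
  semigroup_linear : forall t (a : R) f g x, (0 < t)%R ->
    bounded_borel f -> bounded_borel g -> E x ->
    T t (fun y => a%:E * f y + g y) x = a%:E * T t f x + T t g x;
  semigroup_ge0 : forall t f x, (0 < t)%R -> bounded_borel f ->
    (forall y, E y -> 0 <= f y) -> E x -> 0 <= T t f x;
  semigroup_cst1 : forall t x, (0 < t)%R -> E x -> T t (cst 1) x = 1;
  semigroupD : forall s t f x, (0 < s)%R -> (0 < t)%R -> bounded_borel f ->
    E x -> T (s + t)%R f x = T s (T t f) x }.

Context dO (O : measurableType dO).

Record filtration (F : R -> set (set O)) : Prop := Filtration {
  filtration_sigma_algebra : forall t, (0 <= t)%R -> sigma_algebra setT (F t);
  filtration_measurable : forall t A, (0 <= t)%R -> F t A -> measurable A;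
  filtration_nd : forall s t, (0 <= s)%R -> (s <= t)%R -> F s `<=` F t }.

Variable F : R -> set (set O).

Definition right_continuous_filtration : Prop :=
  forall t, (0 <= t)%R -> F t = \bigcap_(s in [set s | (t < s)%R]) F s.

Definition stopping_time (tau : O -> \bar R) : Prop :=
  (forall w, 0 <= tau w) /\
  forall t, (0 <= t)%R -> F t [set w | tau w <= t%:E].

Definition stopped_sigma_algebra (tau : O -> \bar R) : set (set O) :=
  [set A | measurable A /\
    forall t, (0 <= t)%R -> F t (A `&` [set w | tau w <= t%:E])].

Variables (P : S -> probability O R) (X : R -> O -> S).
Variable T : R -> (S -> \bar R) -> S -> \bar R.

(** The lifetime is infinite: the paths stay in [E], there is no cemetery.
    Only the laws [P x] with [x] in [E] matter. *)
Record hunt_process : Prop := HuntProcess {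
  hunt_semigroup : markov_semigroup T;
  hunt_filtration : filtration F;
  hunt_filtration_rc : right_continuous_filtration;
  hunt_state : forall t w, (0 <= t)%R -> E (X t w);
  hunt_adapted : forall t (B : set (borel S)), (0 <= t)%R -> measurable B ->
    F t (X t @^-1` B);
  hunt_start : forall x, E x -> {ae P x, forall w, X 0%R w = x};
  hunt_cadlag : forall x, E x -> {ae P x, forall w, cadlag E (X ^~ w)};
  hunt_stopped_measurable : forall tau (B : set (borel S)),
    stopping_time tau -> measurable B ->
    stopped_sigma_algebra tau [set w | tau w < +oo /\ B (X (fine (tau w)) w)];
  hunt_strong_markov : forall tau x t f A,
    stopping_time tau -> E x -> (0 < t)%R -> bounded_borel f ->
    stopped_sigma_algebra tau A ->
    \int[P x]_(w in A `&` [set w | tau w < +oo]) f (X (fine (tau w) + t)%R w) =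
    \int[P x]_(w in A `&` [set w | tau w < +oo]) T t f (X (fine (tau w)) w);
  hunt_quasi_left_continuous : forall (tau_ : nat -> O -> \bar R) tau x,
    (forall n, stopping_time (tau_ n)) ->
    (forall n w, tau_ n w <= tau_ n.+1 w) ->
    (forall w, tau w = ereal_sup (range (tau_ ^~ w))) -> E x ->
    {ae P x, forall w, tau w < +oo ->
      X (fine (tau_ n w)) w @[n --> \oo] --> X (fine (tau w)) w} }.

End hunt.

(* Main.v *)
Require Import Defs.
From HB Require Import structures.
From mathcomp Require Import all_boot all_order all_algebra.
From mathcomp Require Import all_classical all_reals all_analysis.
From mathcomp Require Import measurable_realfun.

Set Implicit Arguments.
Unset Strict Implicit.
Unset Printing Implicit Defensive.

Import Order.TTheory GRing.Theory Num.Theory.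
Import numFieldNormedType.Exports.

Local Open Scope classical_set_scope.
Local Open Scope ring_scope.

(** The semigroup [K] forgets the level of the ladder: for a function [f] of the
    position alone, [ladderK t (f o snd) (m, x)] is the sum over [n >= m] of
    [Kn (n - m) t f x], a shifted copy of the series of [Kn n t f x], so it does
    not depend on [m]; exchanging sum and integral turns that series into
    [K t f x].  This identity, [ladderK_snd], carries part (b).  Every axiom of
    a Hunt process for the position with semigroup [K] is the corresponding
    axiom of the ladder process, read on the functions [f o snd] and the sets
    [snd @^-1` B]: the filtration and the stopping times are the same, and [snd]
    is continuous.  The strong Markov property needs the identity at all levels
    [m], since the ladder process may have climbed by the stopping time.

    The analytic content is the exchange of sum and integral, which requires
    the kernels [kn n t x y] to be nonnegative and measurable in [y].  The
    induction on [n] runs through joint measurability in [(t, x, y)], for the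
    product of the Borel sigma-algebras.  For [n = 0] it comes from the joint
    continuity of the heat kernel, as open sets of the product space are
    measurable for the product sigma-algebra.  For the step, integration
    against the mixture of the [mu z] with density [nu] is rewritten as an
    iterated integral ([integral_mixture]); the kernel [kn n.+1] then becomes
    a fourfold iterated integral of a jointly measurable function, to which
    Tonelli's theorem applies.  Signed functions are reduced to nonnegative ones
    through the linearity of the ladder semigroup.

    For part (a), [ladderK t] only sees the values of its argument on the levels
    above the starting one, so that the Markov property at time [q] gives
    probability [0] to the event that the level is [n] at [q] and below [n] at
    [q + r].  Almost surely the level is therefore monotone along the rationals,
    and, being right-continuous with values in a discrete space, it is monotone
    along the reals. *)

(** * Integration against mixtures and kernels *)

Section mixture.
Context d d' (S : measurableType d) (T : measurableType d') (R : realType).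
Variables (m : {measure set S -> \bar R}) (k : S -> {measure set T -> \bar R}).
Hypothesis mk : forall B, measurable B -> measurable_fun setT (k ^~ B).
Variables (E : set S) (h : S -> R).
Hypotheses (mE : measurable E) (mh : measurable_fun E h).
Hypothesis h0 : forall s, E s -> 0 <= h s.
Local Open Scope ereal_scope.

Lemma measurable_fun_weight (g : S -> \bar R) : measurable_fun setT g ->
  measurable_fun E (fun s => (h s)%:E * g s).
Proof.
move=> mg; apply: emeasurable_funM; first exact/measurable_EFinP.
exact: measurable_funTS.
Qed.

Definition mixture (B : set T) := \int[m]_(s in E) ((h s)%:E * k s B).

Let mixture0 : mixture set0 = 0.
Proof. by apply: integral0_eq => s _; rewrite measure0 mule0. Qed.

Let mixture_ge0 B : 0 <= mixture B.
Proof. by apply: integral_ge0 => s Es; rewrite mule_ge0// lee_fin h0. Qed.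

Let mixture_sigma_additive : semi_sigma_additive mixture.
Proof.
move=> F mF tF mUF; rewrite [X in _ --> X](_ : _ =
    \sum_(0 <= n <oo) mixture (F n)); last first.
  rewrite -integral_nneseries//; last 2 first.
  - by move=> n; apply: measurable_fun_weight; exact: mk.
  - by move=> n s Es; rewrite mule_ge0// lee_fin h0.
  apply: eq_integral => s /[!inE] Es.
  by rewrite (measure_semi_bigcup (k s))// -nneseriesZl.
by apply: is_cvg_nneseries => n _ _; exact: mixture_ge0.
Qed.

HB.instance Definition _ := isMeasure.Build _ _ _ mixture mixture0 mixture_ge0
  mixture_sigma_additive.

Import HBNNSimple.

Let integral_mixture_nnsfun (f : {nnsfun T >-> R}) :
  \int[mixture]_t (f t)%:E = \int[m]_(s in E) ((h s)%:E * \int[k s]_t (f t)%:E).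
Proof.
have fk0 s r : 0 <= r%:E * k s (f @^-1` [set r]).
  by apply: (mulemu_ge0 (fun r => f @^-1` [set r])); exact: preimage_nnfun0.
rewrite integralT_nnsfun sintegralE.
under [RHS]eq_integral => s _.
  rewrite integralT_nnsfun sintegralE ge0_mule_fsumr//.
  over.
rewrite ge0_integral_fsum//; last 2 first.
- move=> r; apply: measurable_fun_weight; apply: measurable_funeM.
  exact: mk.
- by move=> r s Es; rewrite mule_ge0// lee_fin h0.
apply: eq_fsbigr => r /[!inE] -[t _ rE].
rewrite /mixture -ge0_integralZl//.
- by apply: eq_integral => s _; rewrite muleCA.
- by apply: measurable_fun_weight; exact: mk.
- by move=> s Es; rewrite mule_ge0// lee_fin h0.
- by rewrite lee_fin -rE.
Qed.

(** Both sides are additive and continuous along increasing sequences, and they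
    agree on indicators by the definition of the mixture. *)
Lemma integral_mixture (f : T -> \bar R) :
  (forall t, 0 <= f t) -> measurable_fun setT f ->
  \int[mixture]_t f t = \int[m]_(s in E) ((h s)%:E * \int[k s]_t f t).
Proof.
move=> f0 mf; pose g := nnsfun_approx measurableT mf.
have mg n : measurable_fun setT (EFin \o g n) by exact/measurable_EFinP.
have g0 n t : 0 <= (g n t)%:E by rewrite lee_fin.
have gnd t : {homo (fun n => (g n t)%:E) : a b / (a <= b)%N >-> a <= b}.
  by move=> a b ab; rewrite lee_fin; exact/lefP/nd_nnsfun_approx.
have glim t : limn (fun n => (g n t)%:E) = f t.
  by apply/cvg_lim => //; exact: cvg_nnsfun_approx.
have intE (l : {measure set T -> \bar R}) :
    \int[l]_t f t = limn (fun n => \int[l]_t (g n t)%:E).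
  by rewrite -monotone_convergence//; apply: eq_integral => t _; rewrite glim.
rewrite intE.
under eq_fun do rewrite integral_mixture_nnsfun.
have kg0 s n : 0 <= \int[k s]_t (g n t)%:E by exact: integral_ge0.
have kgnd s : {homo (fun n => \int[k s]_t (g n t)%:E) :
    a b / (a <= b)%N >-> a <= b}.
  by move=> a b ab; apply: ge0_le_integral => //; [exact: mg|exact: mg|
    by move=> t _; exact: gnd].
rewrite -monotone_convergence//.
- apply: eq_integral => s /[!inE] Es; rewrite intE limeMl//.
  exact: ereal_nondecreasing_is_cvgn.
- move=> n; apply: measurable_fun_weight.
  apply: (measurable_fun_integral_kernel mk (k := fun t => (g n t)%:E)).
    exact: g0.
  exact: mg.
- by move=> n s Es; rewrite mule_ge0// lee_fin h0.
- by move=> s Es a b ab; rewrite lee_wpmul2l ?lee_fin ?h0//; exact: kgnd.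
Qed.

Lemma integral_mixture_in (F : set T) (f : T -> \bar R) :
  (forall t, 0 <= (f \_ F) t) -> measurable_fun setT (f \_ F) ->
  \int[mixture]_(t in F) f t =
  \int[m]_(s in E) ((h s)%:E * \int[k s]_t (f \_ F) t).
Proof. by move=> f0 mf; rewrite -integral_mixture// -integral_mkcond. Qed.

End mixture.

(** In the iterated integrals below the base point of the kernel is only one
    among several parameters of the integrand.  Composing the kernel with a
    projection makes it a kernel from the space of all parameters. *)
Section kernel_pullback.
Context d d' dW (S : measurableType d) (T : measurableType d')
  (W : measurableType dW) (R : realType).
Variables (k : R.-fker S ~> T) (z : W -> S).
Hypothesis mz : measurable_fun setT z.
Local Open Scope ereal_scope.

Definition kernel_pullback (w : W) : {measure set T -> \bar R} := k (z w).

Let measurable_pullback B : measurable B ->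
  measurable_fun setT (kernel_pullback ^~ B).
Proof. by move=> mB; exact: measurableT_comp (measurable_kernel k B mB) mz. Qed.

HB.instance Definition _ :=
  isKernel.Build _ _ _ _ _ kernel_pullback measurable_pullback.

Let pullback_uub : measure_fam_uub kernel_pullback.
Proof. by have [r rP] := measure_uub k; exists r => w; exact: rP. Qed.

HB.instance Definition _ :=
  Kernel_isFinite.Build _ _ _ _ _ kernel_pullback pullback_uub.

Lemma measurable_fun_integral_pullback (f : W * T -> \bar R) :
  (forall u, 0 <= f u) -> measurable_fun setT f ->
  measurable_fun setT (fun w => \int[k (z w)]_t f (w, t)).
Proof.
exact: (@measurable_fun_integral_finite_kernel _ _ _ _ _ f kernel_pullback).
Qed.

End kernel_pullback.

(** * Borel measurability on spaces of vectors *)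

Section borel_vectors.
Context {R : realType}.

(** Open sets are countable unions of rational boxes, that is, of finite
    intersections of conditions on single coordinates. *)
Lemma measurable_fun_rV d dT (T : measurableType dT) (f : T -> 'rV[R]_d) :
  (forall i, measurable_fun setT (fun t => f t 0 i)) ->
  measurable_fun setT (f : T -> Rd R d).
Proof.
move=> mf; apply: (@measurability _ _ _ (Rd R d) _ _ (@open 'rV[R]_d)) => //.
move=> _ [U oU <-]; rewrite setTI (open_rat_box oU) preimage_bigcup.
apply: countable_bigcupT_measurable => // q.
case: asboolP => _; last by rewrite preimage_set0.
rewrite (_ : _ @^-1` _ =
    \bigcap_i ((fun t => f t 0 i) @^-1` ball (ratr (q.1 0 i) : R)
                                        (q.2.+1%:R^-1 : R))); last first.
  by apply/seteqP; split=> t /= H i; [move=> _|]; exact: H.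
apply: fin_bigcap_measurable => // i _; rewrite -[X in measurable X]setTI.
by apply: mf => //; exact: measurable_ball.
Qed.

Lemma measurable_coord d (i : 'I_d) :
  measurable_fun setT (fun v : Rd R d => (v : 'rV[R]_d) 0 i).
Proof.
by apply: measurable_fun_continuous; exact: coord_continuous.
Qed.

Lemma measurable_fun_coord d dT (T : measurableType dT) (f : T -> 'rV[R]_d) i :
  measurable_fun setT (f : T -> Rd R d) ->
  measurable_fun setT (fun t => f t 0 i).
Proof. by move=> mf; exact: (measurableT_comp (measurable_coord i)). Qed.

Lemma continuous_reindex_rV d d' (f : 'I_d' -> 'I_d) :
  continuous (fun v : 'rV[R]_d => \row_i v 0 (f i)).
Proof.
move=> v A /nbhs_ballP[e /= e0 eA]; apply/nbhs_ballP; exists e => // w [_ vw].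
by apply: eA; split=> // i j; rewrite !mxE; exact: vw.
Qed.

(** The Borel sigma-algebra of the product space is contained in the product
    of the Borel sigma-algebras.  Concatenating a triple to one long vector is
    measurable for the product sigma-algebra, coordinate by coordinate, and
    cutting the vector again is continuous; so [W] is the preimage of an open
    set of vectors by a measurable map. *)
Lemma open_measurable_prod d d' (W : set (R * 'rV[R]_d * 'rV[R]_d')) :
  open W -> measurable (W : set (measurableTypeR R * Rd R d * Rd R d')).
Proof.
move=> oW.
pose pack (u : measurableTypeR R * Rd R d * Rd R d') :=
  row_mx (row_mx ((u.1.1)%:M : 'M[R]_1) u.1.2) u.2 : 'rV[R]_(1 + d + d').
pose unpack (v : 'rV[R]_(1 + d + d')) : R * 'rV[R]_d * 'rV[R]_d' :=
  (v 0 (lshift _ (lshift _ 0)), \row_i v 0 (lshift _ (rshift _ i)),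
   \row_i v 0 (rshift _ i)).
have packK : cancel pack unpack.
  move=> [[t x] y]; rewrite /unpack /pack /=; congr (_, _, _).
  - by rewrite !row_mxEl mxE eqxx.
  - by apply/rowP => i; rewrite mxE row_mxEl row_mxEr.
  - by apply/rowP => i; rewrite mxE row_mxEr.
have mpack : measurable_fun setT (pack : _ -> Rd R (1 + d + d')).
  apply: measurable_fun_rV => i.
  case: (split_ordP i) => j -> /=; last first.
    under eq_fun do rewrite row_mxEr.
    exact: measurable_fun_coord.
  case: (split_ordP j) => l -> /=; last first.
    under eq_fun do rewrite row_mxEl row_mxEr.
    apply: measurable_fun_coord.
    exact: (measurableT_comp measurable_snd measurable_fst).
  rewrite (_ : (fun _ => _) = fst \o fst).
  exact: (measurableT_comp measurable_fst measurable_fst).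
  by apply/funext => u; rewrite !row_mxEl (ord1 l) mxE eqxx mulr1n.
have cunpack : continuous unpack.
  have c1 : continuous (fun v : 'rV[R]_(1 + d + d') =>
    v 0 (lshift d' (lshift d 0))) by exact: coord_continuous.
  have c2 : continuous (fun v : 'rV[R]_(1 + d + d') =>
    \row_i v 0 (lshift d' (rshift 1 i))) by exact: continuous_reindex_rV.
  have c3 : continuous (fun v : 'rV[R]_(1 + d + d') =>
    \row_i v 0 (rshift (1 + d) i)) by exact: continuous_reindex_rV.
  by move=> v; have H := cvg_pair (cvg_pair (c1 v) (c2 v)) (c3 v); exact: H.
rewrite (_ : W = pack @^-1` (unpack @^-1` W)); last first.
  by rewrite -comp_preimage (_ : unpack \o pack = id)//; apply/funext.
rewrite -[X in measurable X]setTI; apply: mpack => //.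
by apply: measurable_open; apply: open_comp => // v _; exact: cunpack.
Qed.

Lemma measurable_fun_within_prod d d' (A : set (R * 'rV[R]_d * 'rV[R]_d'))
    (f : R * 'rV[R]_d * 'rV[R]_d' -> R) :
  open A -> {within A, continuous f} ->
  measurable_fun (A : set (measurableTypeR R * Rd R d * Rd R d')) f.
Proof.
move=> oA; rewrite continuous_open_subspace// => cf.
apply: (measurability (@RGenOInfty.G R)) => [|_ [_ [r ->] <-]].
  exact: RGenOInfty.measurableE.
apply: open_measurable_prod; rewrite -[_ `&` _]/(A `&` f @^-1` _).
rewrite openE => u [Au fu]; apply: filterI; first exact: open_nbhs_nbhs.
by apply: cf; [exact: mem_set|exact: open_nbhs_nbhs].
Qed.

Lemma measurable_fun_enormB d dT (T : measurableType dT)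
    (f g : T -> 'rV[R]_d) :
  measurable_fun setT (f : T -> Rd R d) ->
  measurable_fun setT (g : T -> Rd R d) ->
  measurable_fun setT (fun t => enorm (f t - g t)).
Proof.
move=> mf mg; apply: (measurableT_comp (continuous_measurable_fun _)).
  exact: sqrt_continuous.
rewrite /dotr; apply: measurable_sum => i.
under eq_fun do rewrite !mxE.
by apply: measurable_funM; apply: measurable_funB; exact: measurable_fun_coord.
Qed.

Lemma measurable_fun_nu d alpha dT (T : measurableType dT)
    (f g : T -> 'rV[R]_d) :
  measurable_fun setT (f : T -> Rd R d) ->
  measurable_fun setT (g : T -> Rd R d) ->
  measurable_fun setT (fun t => nu alpha (f t) (g t)).
Proof.
move=> mf mg; apply: measurable_funM => //.
by apply: (measurableT_comp (measurable_powR _)); exact: measurable_fun_enormB.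
Qed.

(** The terms of Gauss' product are nonnegative, and the limit of a divergent
    sequence is the default value [0]. *)
Lemma Gamma_ge0 (x : R) : 0 < x -> 0 <= Gamma x.
Proof.
move=> x0; rewrite /Gamma.
have [cv|/dvgP ->//] := pselect (cvg (n`!%:R * n%:R `^ x /
  \prod_(k < n.+1) (x + k%:R) @[n --> \oo])).
apply: limr_ge => //; apply: nearW => n.
rewrite divr_ge0 ?mulr_ge0 ?powR_ge0//; apply: prodr_ge0 => k _.
by rewrite addr_ge0// ltW.
Qed.

Lemma nu_ge0 d (alpha : R) (x z : 'rV[R]_d) : (0 < d)%N -> 0 < alpha ->
  0 <= nu alpha x z.
Proof.
move=> d0 a0; rewrite /nu /stable_const.
rewrite mulr_ge0 ?powR_ge0// divr_ge0 ?mulr_ge0 ?powR_ge0//.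
by rewrite Gamma_ge0// divr_gt0// addr_gt0// ltr0n.
Qed.

End borel_vectors.
(** * The iterated kernels *)

Lemma measurable_fun_triple d d1 d2 d3 (T : measurableType d)
    (T1 : measurableType d1) (T2 : measurableType d2) (T3 : measurableType d3)
    (f : T -> T1) (g : T -> T2) (h : T -> T3) :
  measurable_fun setT f -> measurable_fun setT g -> measurable_fun setT h ->
  measurable_fun setT (fun t => (f t, g t, h t)).
Proof.
move=> mf mg mh; apply: measurable_fun_pair => //.
exact: measurable_fun_pair.
Qed.

Lemma measurable_fun_fst d d1 d2 (T : measurableType d)
    (T1 : measurableType d1) (T2 : measurableType d2) (f : T -> T1 * T2) :
  measurable_fun setT f -> measurable_fun setT (fun t => (f t).1).
Proof. by case/measurable_fun_pairP. Qed.

Lemma measurable_fun_snd d d1 d2 (T : measurableType d)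
    (T1 : measurableType d1) (T2 : measurableType d2) (f : T -> T1 * T2) :
  measurable_fun setT f -> measurable_fun setT (fun t => (f t).2).
Proof. by case/measurable_fun_pairP. Qed.

Section iterated_kernels.
Context {R : realType} (d : nat) (alpha : R) (D : set 'rV[R]_d).
Variables (p : R -> 'rV[R]_d -> 'rV[R]_d -> R).
Variables (mu : R.-pker (Rd R d) ~> (Rd R d)).
Hypotheses (d_gt0 : (0 < d)%N) (alpha_gt0 : 0 < alpha) (oD : open D).

Definition kernel_domain : set (R * 'rV[R]_d * 'rV[R]_d) :=
  [set u | [/\ 0 < u.1.1, D u.1.2 & D u.2]].

Hypothesis p_ge0 : forall t x y, 0 < t -> D x -> D y -> 0 <= p t x y.
Hypothesis p_continuous :
  {within kernel_domain, continuous (fun u => p u.1.1 u.1.2 u.2)}.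
Local Open Scope ereal_scope.

Notation S := (measurableTypeR R * Rd R d * Rd R d)%type.

Lemma open_kernel_domain : open kernel_domain.
Proof.
rewrite (_ : kernel_domain = (fun u => u.1.1) @^-1` [set t | (0 < t)%R] `&`
    ((fun u => u.1.2) @^-1` D `&` snd @^-1` D)); last first.
  by apply/seteqP; split => u /= []// ? [].
apply: openI; [|apply: openI]; apply: open_comp => // -[[t x] y] _.
- by apply: cvg_comp; exact: cvg_fst.
- by apply: cvg_comp; [exact: cvg_fst|exact: cvg_snd].
- exact: cvg_snd.
Qed.

Let mdom : measurable (kernel_domain : set S).
Proof. exact: open_measurable_prod open_kernel_domain. Qed.

Let mD : measurable (D : set (Rd R d)). Proof. exact: measurable_open. Qed.

(** Extending by zero makes the constraints [0 < s < t], [v] in [D] and [w] in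
    [D] of the recursion automatic, so that all integrals range over whole
    spaces. *)
Definition kn_ext n (u : S) : \bar R :=
  ((fun u => kn alpha D p mu n u.1.1 u.1.2 u.2) \_ kernel_domain) u.

Lemma kn_extE n t x y : (0 < t)%R -> D x -> D y ->
  kn_ext n (t, x, y) = kn alpha D p mu n t x y.
Proof. by move=> t0 Dx Dy; rewrite /kn_ext patchE mem_set. Qed.

Lemma kn_ext_out n t x y :
  ~ [/\ (0 < t)%R, D x & D y] -> kn_ext n (t, x, y) = 0.
Proof. by move=> H; rewrite /kn_ext patchE memNset. Qed.

Let measurable_kn_ext n :
  measurable_fun (kernel_domain : set S)
    (fun u => kn alpha D p mu n u.1.1 u.1.2 u.2) ->
  measurable_fun setT (kn_ext n).
Proof. by move/(measurable_restrictT _ mdom). Qed.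

Lemma kn_ext0_ge0 u : 0 <= kn_ext 0 u.
Proof.
rewrite /kn_ext patchE; case: ifPn => // /[!inE] -[t0 Dx Dy].
by rewrite lee_fin p_ge0.
Qed.

Lemma measurable_kn_ext0 : measurable_fun setT (kn_ext 0).
Proof.
apply: measurable_kn_ext; rewrite -[X in measurable_fun _ X]/(EFin \o
  (fun u => p u.1.1 u.1.2 u.2)); apply/measurable_EFinP.
exact: measurable_fun_within_prod open_kernel_domain p_continuous.
Qed.

(** What remains under the integrals over [s] and [v] in the recursion for
    [kn n.+1 t x y] once [nu_mu v], a mixture of the [mu z], is integrated in
    the order [w], [z]. *)
Definition kn_integrand n t x y s v : \bar R :=
  \int[lebesgue_rV d]_(z in ~` D) ((nu alpha v z)%:E *
    \int[mu z]_w (kn_ext 0 (s, x, v) * kn_ext n (t - s, w, y)%R)).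

(** Three applications of Tonelli's theorem, over [s], [v] and [z], to the
    integral over [w], which is measurable in all parameters because [mu] is a
    kernel. *)
Lemma measurable_kn_integrand n : (forall u, 0 <= kn_ext n u) ->
  measurable_fun setT (kn_ext n) ->
  measurable_fun setT (fun u : S =>
    \int[lebesgue_measure]_s \int[lebesgue_rV d]_v
      kn_integrand n u.1.1 u.1.2 u.2 s v).
Proof.
move=> ge0 mkn.
(* A point of [A] is [(t, x, y, s, v, z)]. *)
pose A := (S * measurableTypeR R * Rd R d * Rd R d)%type.
pose g (a : A) := \int[mu a.2]_w (kn_ext 0 (a.1.1.2, a.1.1.1.1.2, a.1.2) *
  kn_ext n (a.1.1.1.1.1 - a.1.1.2, w, a.1.1.1.2)%R).
have g0 a : 0 <= g a.
  by apply: integral_ge0 => w _; rewrite mule_ge0// kn_ext0_ge0.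
have mg : measurable_fun setT g.
  apply: (@measurable_fun_integral_pullback _ _ _ _ _ A R mu snd _
    (fun c : A * Rd R d =>
    kn_ext 0 (c.1.1.1.2, c.1.1.1.1.1.2, c.1.1.2) *
    kn_ext n (c.1.1.1.1.1.1 - c.1.1.1.2, c.2, c.1.1.1.1.2)%R)) => //.
    by move=> c; rewrite mule_ge0// kn_ext0_ge0.
  apply: emeasurable_funM.
    apply: (measurableT_comp measurable_kn_ext0); apply: measurable_fun_triple.
    - by apply: measurable_fun_snd; do 3 apply: measurable_fun_fst.
    - by apply: measurable_fun_snd; do 5 apply: measurable_fun_fst.
    - by apply: measurable_fun_snd; do 2 apply: measurable_fun_fst.
  apply: (measurableT_comp mkn); apply: measurable_fun_triple => //.
    apply: measurable_funB; first by do 6 apply: measurable_fun_fst.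
    by apply: measurable_fun_snd; do 3 apply: measurable_fun_fst.
  by apply: measurable_fun_snd; do 4 apply: measurable_fun_fst.
(* The restriction of the integral in [z] to the complement of [D] becomes an
   indicator, as Tonelli's theorem is applied on whole spaces. *)
pose h (a : A) : \bar R :=
  (\1_(~` D) a.2 * nu alpha a.1.2 a.2)%:E * g a.
have h0 a : 0 <= h a by rewrite mule_ge0// lee_fin mulr_ge0// nu_ge0.
have mh : measurable_fun setT h.
  apply: emeasurable_funM => //; apply/measurable_EFinP; apply: measurable_funM.
    apply: (measurableT_comp _ (measurable_snd)).
    by apply: measurable_indic; exact: measurableC.
  apply: measurable_fun_nu => //.
  exact: (measurableT_comp measurable_snd measurable_fst).
rewrite (_ : (fun _ => _) = fubini_F lebesgue_measure (fubini_F (lebesgue_rV d)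
    (fubini_F (lebesgue_rV d) h))).
  apply: measurable_fun_fubini_tonelli_F.
    apply: measurable_fun_fubini_tonelli_F.
      exact: measurable_fun_fubini_tonelli_F.
    by move=> a; exact: integral_ge0.
  by move=> a; apply: integral_ge0 => v _; exact: integral_ge0.
apply/funext => u; apply: eq_integral => s _; apply: eq_integral => v _.
rewrite /kn_integrand integral_mkcond; apply: eq_integral => z _.
rewrite patchE /h /= indicE; case: ifPn => _; first by rewrite mul1r.
by rewrite mul0r mul0e.
Qed.

Lemma kn_rec n t x y : (forall u, 0 <= kn_ext n u) ->
  measurable_fun setT (kn_ext n) -> D x -> D y ->
  kn alpha D p mu n.+1 t x y =
  \int[lebesgue_measure]_s \int[lebesgue_rV d]_v kn_integrand n t x y s v.
Proof.
move=> ge0 mkn Dx Dy; rewrite /= integral_mkcond.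
have integrand0 s v :
    (forall w, kn_ext 0 (s, x, v) * kn_ext n (t - s, w, y)%R = 0) ->
    kn_integrand n t x y s v = 0.
  move=> kk0; apply: integral0_eq => z _.
  by rewrite integral0_eq ?mule0// => w _; exact: kk0.
apply: eq_integral => s _; rewrite patchE; case: ifPn => [|]; last first.
  rewrite notin_setE/= in_itv/= => st.
  rewrite integral0_eq// => v _; apply: integrand0 => w.
  have [s0|s0] := leP s 0%R.
    by rewrite [kn_ext 0 _]kn_ext_out ?mul0e// => -[+ _ _]; rewrite ltNge s0.
  rewrite [kn_ext n _]kn_ext_out ?mule0// => -[+ _ _].
  by rewrite subr_gt0 => s_lt_t; move: st; rewrite s0 s_lt_t.
rewrite inE/= in_itv/= => /andP[s0 st].
rewrite integral_mkcond; apply: eq_integral => v _.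
rewrite patchE; case: ifPn => [|]; last first.
  rewrite notin_setE => Dv; rewrite integrand0// => w.
  by rewrite [kn_ext 0 _]kn_ext_out ?mul0e// => -[].
rewrite inE => Dv.
have restrictE : (fun w => (p s x v)%:E * kn alpha D p mu n (t - s) w y) \_ D =
    (fun w => kn_ext 0 (s, x, v) * kn_ext n (t - s, w, y)%R).
  apply/funext => w; rewrite patchE kn_extE//; case: ifPn => [|]; last first.
    by rewrite notin_setE => Dw; rewrite [kn_ext n _]kn_ext_out ?mule0// => -[].
  by rewrite inE => Dw; rewrite kn_extE ?subr_gt0.
rewrite /kn_integrand -restrictE.
apply: (@integral_mixture_in _ _ _ _ _ (lebesgue_rV d) mu _ (~` D)
  (nu alpha v)).
- exact: measurable_kernel.
- exact: measurableC.
- by apply: measurable_funTS; exact: measurable_fun_nu.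
- by move=> z _; exact: nu_ge0.
- by move=> w; rewrite restrictE mule_ge0// kn_ext0_ge0.
- rewrite restrictE; apply: measurable_funeM; apply: (measurableT_comp mkn).
  exact: measurable_fun_triple.
Qed.

(** Measurability of [kn n] is needed to unfold the integral against [nu_mu] in
    [kn n.+1] even for the nonnegativity, hence the simultaneous induction. *)
Lemma kn_ext_ge0_measurable n :
  (forall u, 0 <= kn_ext n u) /\ measurable_fun setT (kn_ext n).
Proof.
elim: n => [|n [ge0 mkn]].
  by split; [exact: kn_ext0_ge0|exact: measurable_kn_ext0].
split => [[[t x] y]|].
  rewrite /kn_ext patchE; case: ifPn => // /[!inE] -[t0 Dx Dy].
  rewrite kn_rec//.
  apply: integral_ge0 => s _; apply: integral_ge0 => v _.
  apply: integral_ge0 => z _; rewrite mule_ge0// ?lee_fin ?nu_ge0//.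
  by apply: integral_ge0 => w _; rewrite mule_ge0// kn_ext0_ge0.
apply: measurable_kn_ext.
apply: eq_measurable_fun (measurable_funTS (measurable_kn_integrand ge0 mkn)).
by move=> -[[t x] y] /[!inE] -[t0 Dx Dy]; rewrite kn_rec.
Qed.

Lemma kn_ge0 n t x y : (0 < t)%R -> D x -> D y -> 0 <= kn alpha D p mu n t x y.
Proof.
by move=> t0 Dx Dy; rewrite -kn_extE//; have [+ _] := kn_ext_ge0_measurable n.
Qed.

Lemma measurable_kn n t x : (0 < t)%R -> D x ->
  measurable_fun (D : set (Rd R d)) (fun y => kn alpha D p mu n t x y).
Proof.
move=> t0 Dx; have [_ mkn] := kn_ext_ge0_measurable n.
apply: (eq_measurable_fun (fun y => kn_ext n (t, x, y))).
  by move=> y /[!inE] Dy; rewrite kn_extE.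
apply: measurable_funTS; apply: (measurableT_comp mkn).
exact: measurable_fun_triple.
Qed.

Lemma ksum_ge0 t x y : (0 < t)%R -> D x -> D y -> 0 <= ksum alpha D p mu t x y.
Proof. by move=> t0 Dx Dy; apply: nneseries_ge0 => n _ _; exact: kn_ge0. Qed.

(** Finiteness of [f] allows [f y] to enter the series of the [kn n t x y]. *)
Lemma K_series t (f : 'rV[R]_d -> \bar R) x : (0 < t)%R -> D x ->
  measurable_fun (D : set (Rd R d)) (f : Rd R d -> \bar R) ->
  (forall y, D y -> 0 <= f y) -> (forall y, D y -> f y \is a fin_num) ->
  K alpha D p mu t f x = \sum_(0 <= n <oo) Kn alpha D p mu n t f x.
Proof.
move=> t0 Dx mf f0 ff; rewrite /K /Kn -integral_nneseries//; last 2 first.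
- by move=> n; apply: emeasurable_funM => //; exact: measurable_kn.
- by move=> n y Dy; rewrite mule_ge0 ?f0// kn_ge0.
apply: eq_integral => y /[!inE] Dy; rewrite muleC -(fineK (ff _ Dy)).
rewrite -nneseriesZl; first by under eq_eseriesr do rewrite muleC.
by move=> n _; exact: kn_ge0.
Qed.

Lemma ladderK_series t (f : 'rV[R]_d -> \bar R) m x : (0 < t)%R -> D x ->
  (forall y, D y -> 0 <= f y) ->
  ladderK alpha D p mu t (f \o snd) (m, x) =
  \sum_(0 <= n <oo) Kn alpha D p mu n t f x.
Proof.
move=> t0 Dx f0.
rewrite /ladderK /= -[LHS](nneseries_addn m); last first.
  by move=> n; apply: integral_ge0 => y Dy; rewrite mule_ge0 ?f0// kn_ge0.
by apply: eq_eseriesr => n _; rewrite addnK.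
Qed.

Let mule_max0 (a b : \bar R) : 0 <= a -> maxe (a * b) 0 = a * maxe b 0.
Proof.
move=> a0; have [b0|/ltW b0] := leP 0 b.
  by rewrite !max_l// mule_ge0.
by rewrite !max_r// ?mule0// mule_ge0_le0.
Qed.

(** [ksum] is nonnegative, so multiplication by it commutes with taking positive
    and negative parts. *)
Lemma K_posneg t (f : 'rV[R]_d -> \bar R) x : (0 < t)%R -> D x ->
  K alpha D p mu t f x =
  K alpha D p mu t f^\+ x - K alpha D p mu t f^\- x.
Proof.
move=> t0 Dx; rewrite /K integralE.
congr (_ - _); apply: eq_integral => y /[!inE] Dy.
  by rewrite !funeposE mule_max0// ksum_ge0.
by rewrite !funenegE -muleN mule_max0// ksum_ge0.
Qed.

End iterated_kernels.

(** * The semigroup of the position *)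

Lemma measurable_fun_borel_continuous (S1 S2 : ptopologicalType)
    (g : S1 -> S2) :
  continuous g -> measurable_fun setT (g : borel S1 -> borel S2).
Proof.
move=> cg; apply: (@measurability _ _ _ (borel S2) _ _ (@open S2)) => //.
move=> _ [U oU <-]; rewrite setTI; apply: measurable_open.
by apply: open_comp => // x _; exact: cg.
Qed.

Section bounded_borel_functions.
Context {R : realType} (S : ptopologicalType) (E : set S).
Local Open Scope ereal_scope.

Lemma bounded_borel_funepos (f : S -> \bar R) :
  bounded_borel E f -> bounded_borel E f^\+.
Proof.
move=> [mf [M fM]]; split; first exact: measurable_funepos.
exists M => x Ex; apply: le_trans (fM x Ex).
by rewrite funeposE; have [//|_] := leP 0 (f x); rewrite abse0 abse_ge0.
Qed.

Lemma bounded_borel_funeneg (f : S -> \bar R) :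
  bounded_borel E f -> bounded_borel E f^\-.
Proof.
move=> [mf [M fM]]; split; first exact: measurable_funeneg.
exists M => x Ex; apply: le_trans (fM x Ex).
rewrite funenegE; have [f0|f0] := leP 0 (f x).
  by rewrite max_r ?abse0 ?abse_ge0// oppe_le0.
by rewrite max_l ?abseN// oppe_ge0 ltW.
Qed.

Lemma bounded_borel_affine (a : R) (f g : S -> \bar R) :
  bounded_borel E f -> bounded_borel E g ->
  bounded_borel E (fun y => a%:E * f y + g y).
Proof.
move=> [mf [M fM]] [mg [N gN]]; split.
  by apply: emeasurable_funD => //; exact: measurable_funeM.
exists (`|a| * M + N)%R => y Ey; apply: le_trans (lee_abs_add _ _) _.
by rewrite EFinD leeD ?gN// abseM EFinM lee_wpmul2l// fM.
Qed.

Lemma bounded_borel_fin_num (f : S -> \bar R) y :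
  bounded_borel E f -> E y -> f y \is a fin_num.
Proof.
move=> [_ [M fM]] Ey; rewrite fin_num_abs.
exact: le_lt_trans (fM y Ey) (ltry _).
Qed.

End bounded_borel_functions.

Section semigroup_transfer.
Local Open Scope ereal_scope.

Context {R : realType} (d : nat) (D : set 'rV[R]_d).
Hypothesis oD : open D.

Lemma continuous_snd :
  continuous (@snd nat 'rV[R]_d).
Proof. by move=> z; exact: cvg_snd. Qed.

Lemma continuous_fst : continuous (@fst nat 'rV[R]_d).
Proof. by move=> z; exact: cvg_fst. Qed.

Lemma open_ladder : open (ladder D).
Proof.
rewrite (_ : ladder D = snd @^-1` D).
  by apply: open_comp => // z _; exact: continuous_snd.
by apply/seteqP; split => z /= => [[]|].
Qed.

Lemma measurable_preimage_snd (B : set (Rd R d)) : measurable B ->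
  measurable (snd @^-1` B : set (borel (nat * 'rV[R]_d)%type)).
Proof.
move=> mB; rewrite -[X in measurable X]setTI.
exact: measurable_fun_borel_continuous continuous_snd _ _ mB.
Qed.

Lemma bounded_borel_snd (f : 'rV[R]_d -> \bar R) :
  bounded_borel D f -> bounded_borel (ladder D) (f \o snd).
Proof.
move=> [mf [M fM]]; split; last by exists M => -[m x] [_ Dx]; exact: fM.
move=> _ B mB; rewrite (_ : _ `&` _ = snd @^-1` (D `&` f @^-1` B)).
  by apply: measurable_preimage_snd; apply: mf => //; exact: measurable_open.
by apply/seteqP; split=> -[m x] /= => [[[_ Dx] Bf]|[Dx Bf]].
Qed.

Variables (alpha : R) (p : R -> 'rV[R]_d -> 'rV[R]_d -> R).
Variables (mu : R.-pker (Rd R d) ~> (Rd R d)).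
Hypotheses (d_gt0 : (0 < d)%N) (alpha_gt0 : (0 < alpha)%R).
Hypothesis p_ge0 : forall t x y, (0 < t)%R -> D x -> D y -> (0 <= p t x y)%R.
Hypothesis p_continuous :
  {within kernel_domain D, continuous (fun u => p u.1.1 u.1.2 u.2)}.
Hypothesis ladder_semigroup :
  markov_semigroup (ladder D) (ladderK alpha D p mu).

(** The ladder semigroup ignores the level on functions of the position.  For
    signed [f] the two sides define the same splitting differently: on the
    left a series of differences, on the right a difference of series.
    Linearity of the ladder semigroup avoids summability arguments. *)
Lemma ladderK_snd t (f : 'rV[R]_d -> \bar R) m x : (0 < t)%R ->
  bounded_borel D f -> D x ->
  ladderK alpha D p mu t (f \o snd) (m, x) = K alpha D p mu t f x.
Proof.
move=> t0 bf Dx.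
have bpos := bounded_borel_funepos bf; have bneg := bounded_borel_funeneg bf.
have KE g : bounded_borel D g -> (forall y, 0 <= g y) ->
    ladderK alpha D p mu t (g \o snd) (m, x) = K alpha D p mu t g x.
  move=> bg g0; rewrite ladderK_series// K_series//; first by case: bg.
  by move=> y Dy; exact: (bounded_borel_fin_num bg Dy).
have fE : f \o snd = (fun z : nat * 'rV[R]_d =>
    (-1)%:E * (f^\- \o snd) z + (f^\+ \o snd) z).
  apply/funext => z /=; rewrite mulN1e addeC.
  exact: (congr1 (fun g => g z.2) (funeposneg f)).
rewrite fE (semigroup_linear ladder_semigroup)//.
- by rewrite mulN1e addeC (KE _ bpos)// (KE _ bneg)// -K_posneg.
- exact: bounded_borel_snd.
- exact: bounded_borel_snd.
Qed.

Lemma K_markov_semigroup : markov_semigroup D (K alpha D p mu).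
Proof.
have KE t f x : (0 < t)%R -> bounded_borel D f -> D x ->
    K alpha D p mu t f x = ladderK alpha D p mu t (f \o snd) (0%N, x).
  by move=> *; rewrite ladderK_snd.
have bK t f : (0 < t)%R -> bounded_borel D f ->
    bounded_borel D (K alpha D p mu t f).
  move=> t0 bf.
  have [mT [M TM]] :=
    semigroup_bounded ladder_semigroup t0 (bounded_borel_snd bf).
  split; last by exists M => x Dx; rewrite KE//; exact: TM.
  move=> _ B mB; rewrite (_ : _ `&` _ = (fun x => (0%N, x)) @^-1`
      (ladder D `&` ladderK alpha D p mu t (f \o snd) @^-1` B)); last first.
    apply/seteqP; split=> x /=; first by move=> [Dx]; rewrite KE.
    by move=> [[_ Dx]]; rewrite -KE.
  rewrite -[X in measurable X]setTI.
  apply: (measurable_fun_borel_continuous (g := pair 0%N)) => //.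
    by move=> x; have H := cvg_pair (@cvg_cst nat 0%N _ (nbhs x) _)
        (@cvg_id _ (nbhs x));
      exact: H.
  by apply: mT => //; apply: measurable_open; exact: open_ladder.
split => //.
- move=> t a f g x t0 bf bg Dx.
  rewrite !KE//; last exact: bounded_borel_affine.
  exact: (semigroup_linear ladder_semigroup) (bounded_borel_snd bf)
    (bounded_borel_snd bg) _.
- move=> t f x t0 bf f0 Dx; rewrite KE//.
  apply: (semigroup_ge0 ladder_semigroup) => //; first exact: bounded_borel_snd.
  by move=> [m y] [_ Dy]; exact: f0.
- move=> t x t0 Dx; rewrite KE//.
    exact: (semigroup_cst1 ladder_semigroup).
  split; first exact: measurable_cst.
  by exists 1%R => y _; rewrite abse1.
- move=> s t f x s0 t0 bf Dx.
  rewrite KE ?addr_gt0// (semigroupD ladder_semigroup)//; last first.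
    exact: bounded_borel_snd.
  rewrite KE//; last exact: bK.
  apply: eq_eseriesr => n _; apply: eq_integral => y /[!inE] Dy.
  by rewrite ladderK_snd.
Qed.

End semigroup_transfer.
(** * The ladder process and its two components *)

Section ladder_process.
Context {R : realType} (d : nat) (alpha : R) (D : set 'rV[R]_d).
Variables (p : R -> 'rV[R]_d -> 'rV[R]_d -> R).
Variables (mu : R.-pker (Rd R d) ~> (Rd R d)).
Context dX (OX : measurableType dX).
Variables (P : nat * 'rV[R]_d -> probability OX R).
Variables (F : R -> set (set OX)) (X : R -> OX -> nat * 'rV[R]_d).
Hypothesis X_hunt :
  hunt_process (ladder D) F P X (ladderK alpha D p mu).
Hypothesis oD : open D.

Section projection.
Hypotheses (d_gt0 : (0 < d)%N) (alpha_gt0 : 0 < alpha).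
Hypothesis p_ge0 : forall t x y, 0 < t -> D x -> D y -> 0 <= p t x y.
Hypothesis p_continuous :
  {within kernel_domain D, continuous (fun u => p u.1.1 u.1.2 u.2)}.

Lemma hunt_process_snd :
  hunt_process D F (fun x => P (0%N, x)) (fun t w => (X t w).2)
    (K alpha D p mu).
Proof.
have semi := hunt_semigroup X_hunt.
have ladder0 x : D x -> ladder D (0%N, x) by split.
split.
- exact: K_markov_semigroup.
- exact: hunt_filtration X_hunt.
- exact: hunt_filtration_rc X_hunt.
- by move=> t w t0; have [] := hunt_state X_hunt w t0.
- move=> t B t0 mB.
  exact: (hunt_adapted X_hunt t0 (measurable_preimage_snd mB)).
- move=> x Dx; have := hunt_start X_hunt (ladder0 _ Dx).
  by apply: filterS => w ->.
- move=> x Dx; have := hunt_cadlag X_hunt (ladder0 _ Dx).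
  apply: filterS => w [rc ll]; split=> [t t0|t t0].
    by apply: cvg_comp (rc t t0) _; exact: continuous_snd.
  have [l [_ Dl] cl] := ll t t0; exists l.2 => //.
  by apply: cvg_comp cl _; exact: continuous_snd.
- move=> tau B tauS mB.
  exact: (hunt_stopped_measurable X_hunt tauS (measurable_preimage_snd mB)).
- move=> tau x t f A tauS Dx t0 bf FA.
  have := hunt_strong_markov X_hunt tauS (ladder0 _ Dx) t0
    (bounded_borel_snd oD bf) FA.
  move=> /= ->; apply: eq_integral => w /[!inE] -[_ /= tau_oo].
  have tau0 : 0 <= fine (tau w) by rewrite fine_ge0//; exact: tauS.1.
  have [_] := hunt_state X_hunt w tau0.
  case: (X (fine (tau w)) w) => m y /= Dy; exact: ladderK_snd.
- move=> tau_ tau x tauS tau_nd tauE Dx.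
  have := hunt_quasi_left_continuous X_hunt tauS tau_nd tauE (ladder0 _ Dx).
  apply: filterS => w h /h{}h.
  by apply: cvg_comp h _; exact: continuous_snd.
Qed.

End projection.

Let stopping_cst (q : R) : 0 <= q -> stopping_time F (fun=> q%:E).
Proof.
move=> q0; split => [_|t t0]; first by rewrite lee_fin.
have [F0 FC _] := filtration_sigma_algebra (hunt_filtration X_hunt) t0.
have [qt|qt] := leP q t.
  rewrite (_ : [set _ | _] = setT `\` set0); first exact: FC.
  by rewrite setD0; apply/seteqP; split => w //= _; rewrite lee_fin.
rewrite (_ : [set _ | _] = set0)//.
by apply/seteqP; split => w //=; rewrite lee_fin leNgt qt.
Qed.

Let measurable_level_set (B : set nat) :
  measurable ([set u | B u.1] : set (borel (nat * 'rV[R]_d)%type)).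
Proof.
apply: measurable_open; apply: (@open_comp _ _ fst B).
  by move=> u _; exact: continuous_fst.
exact: discrete_open.
Qed.

Let measurable_level t (B : set nat) : 0 <= t ->
  measurable [set w | B (X t w).1].
Proof.
move=> t0; apply: (filtration_measurable (hunt_filtration X_hunt) t0).
exact: (hunt_adapted X_hunt t0 (measurable_level_set B)).
Qed.

(** The levels that [ladderK] sums over start at [m], where the indicator
    already vanishes. *)
Lemma ladderK_below t m n y : (n <= m)%N ->
  ladderK alpha D p mu t
    (fun u => (\1_[set u : nat * 'rV[R]_d | (u.1 < n)%N] u)%:E)
    (m, y) = 0%E.
Proof.
move=> nm; apply: eseries0 => k /= mk _; apply: integral0_eq => v _.
rewrite indicE memNset ?mule0//=; apply/negP.
by rewrite -leqNgt (leq_trans nm).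
Qed.

(** For each of the countably many values [n] of the level at time [q], the
    Markov property turns the probability of falling below [n] into an integral
    of zero. *)
Lemma level_nondecreasing_at q r z : 0 <= q -> 0 <= r -> ladder D z ->
  {ae P z, forall w, ((X q w).1 <= (X (q + r) w).1)%N}.
Proof.
move=> q0; rewrite le_eqVlt => /predU1P[<-|r0] Dz.
  by rewrite addr0; apply: aeW.
suff : {ae P z, forall w n, (X q w).1 = n -> (n <= (X (q + r) w).1)%N}.
  by apply: filterS => w; exact.
apply: ae_foralln => n.
pose A := [set w | (q%:E < +oo)%E /\ (X (fine q%:E) w).1 = n].
pose B := [set u : nat * 'rV[R]_d | (u.1 < n)%N].
have mB : measurable (B : set (borel (nat * 'rV[R]_d)%type)).
  exact: (measurable_level_set [set k | (k < n)%N]).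
have qr0 : 0 <= q + r by rewrite addr_ge0// ltW.
have AE : A = [set w | (X q w).1 = n].
  by apply/seteqP; split => w /= => [[]|? //]; rewrite /A/= ltry.
have bB : bounded_borel (ladder D) (fun u => (\1_B u : R)%:E).
  split; last first.
    by exists 1 => u _; rewrite lee_fin ger0_norm// indicE lern1 leq_b1.
  apply: measurable_funTS; apply/measurable_EFinP.
  exact: measurable_indic.
have := hunt_strong_markov X_hunt (stopping_cst q0) Dz r0 bB
  (hunt_stopped_measurable X_hunt (stopping_cst q0)
    (measurable_level_set [set n])).
rewrite -/A setIidl; last by move=> w _ /=; rewrite ltry.
have mA : measurable A by rewrite AE; exact: (measurable_level [set n]).
rewrite [in X in _ = X -> _]integral0_eq; last first.
  move=> w; rewrite AE /=; case: (X q w) => m y /= ->; exact: ladderK_below.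
rewrite (_ : (fun _ => _) =
    (fun w => (\1_[set w | ((X (q + r) w).1 < n)%N] w)%:E))//.
have mC : measurable [set w | ((X (q + r) w).1 < n)%N].
  exact: (measurable_level [set k | (k < n)%N]).
rewrite integral_indic// => PCA0.
exists ([set w | ((X (q + r) w).1 < n)%N] `&` A); split => //.
  exact: measurableI.
move=> w /= /not_implyP[Nn /negP]; rewrite -ltnNge => ltn.
by split => //; rewrite AE.
Qed.

Lemma level_nondecreasing_cadlag z : ladder D z ->
  {ae P z, forall w,
    (forall s t, 0 <= s -> s <= t -> ((X s w).1 <= (X t w).1)%N) /\
    cadlag setT (fun t => (X t w).1)}.
Proof.
move=> Dz.
have level_rat : {ae P z, forall w (n : nat), if unpickle n is Some (q, q')
    then 0 <= ratr q :> R -> ratr q <= ratr q' :> R ->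
      ((X (ratr q) w).1 <= (X (ratr q') w).1)%N else True}.
  apply: ae_foralln => n.
  case: (unpickle n) => [[q q']|]; last exact: aeW.
  have [q0|_] := leP 0 (ratr q : R); last exact: aeW.
  have [qq'|_] := leP (ratr q : R) (ratr q'); last exact: aeW.
  have := @level_nondecreasing_at (ratr q) (ratr q' - ratr q) z q0.
  rewrite subr_ge0 => /(_ qq' Dz).
  by apply: filterS => w + _ _; rewrite subrKC.
have := hunt_cadlag X_hunt Dz; apply: filterS2 level_rat => w Nrat [rc ll].
have Nrc t : 0 <= t -> (X s w).1 @[s --> t^'+] --> (X t w).1.
  move=> t0; apply: cvg_comp (rc t t0) _; exact: continuous_fst.
split; last first.
  split=> [|t t0]; first exact: Nrc.
  have [l _ cl] := ll t t0; exists l.1 => //.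
  by apply: cvg_comp cl _; exact: continuous_fst.
(* Right-continuity in a discrete space: the level is constant on a right
   neighbourhood of each time, where a rational can be chosen. *)
have ratN t u : 0 <= t -> t < u -> exists q : rat,
    [/\ t < ratr q, ratr q < u & (X (ratr q) w).1 = (X t w).1].
  move=> t0 tu.
  have : \forall s \near t^'+, (X s w).1 = (X t w).1.
    apply: (Nrc t t0 [set (X t w).1]); apply: open_nbhs_nbhs.
    by split => //; exact: discrete_open.
  move=> /nbhs_ballP[e /= e0 eN].
  have /rat_in_itvoo[q] : t < Num.min u (t + e) by rewrite lt_min tu ltrDl.
  rewrite in_itv/= lt_min => /and3P[tq qu qe]; exists q; split => //.
  apply: eN => //=; rewrite /ball/= distrC gtr0_norm ?subr_gt0//.
  by rewrite ltrBlDl.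
move=> s t s0; rewrite le_eqVlt => /predU1P[->//|st].
have [q [sq qt <-]] := ratN s t s0 st.
have t_lt_t1 : t < t + 1 by rewrite ltrDl.
have [q' [tq' _ <-]] := ratN t (t + 1) (le_trans s0 (ltW st)) t_lt_t1.
have := Nrat (pickle (q, q')); rewrite pickleK; apply.
  exact: le_trans s0 (ltW sq).
exact: ltW (lt_trans qt tq').
Qed.

End ladder_process.
Theorem theorem4p3 (R : realType) (d : nat) (d_gt0 : (0 < d)%N)
  (alpha : R) (alpha_gt0 : 0 < alpha) (alpha_lt2 : alpha < 2)
  (D : set 'rV[R]_d) (D_nonempty : D !=set0) (D_bounded : bounded_set D)
  (D_open : open D) (D_lipschitz : lipschitz_set D)
  (dY : measure_display) (OY : measurableType dY) (PY : probability OY R)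
  (PY_complete : measure_is_complete PY)
  (Y : R -> OY -> 'rV[R]_d) (Y_stable : isotropic_stable PY Y alpha)
  (p : R -> 'rV[R]_d -> 'rV[R]_d -> R)
  (p_heat_kernel : dirichlet_heat_kernel PY Y D p)
  (mu : R.-pker (Rd R d) ~> (Rd R d))
  (mu_D : forall z, ~ D z -> mu z D = 1%E)
  (H : set 'rV[R]_d) (H_compact : compact H) (H_sub : H `<=` D)
  (H_mu : (0 < ereal_inf [set mu z H | z in ~` D])%E)
  (dX : measure_display) (OX : measurableType dX)
  (P : nat * 'rV[R]_d -> probability OX R)
  (F : R -> set (set OX)) (X : R -> OX -> nat * 'rV[R]_d)
  (X_hunt : hunt_process (ladder D) F P X (ladderK alpha D p mu)) :
  (forall z, ladder D z ->
    {ae P z, forall w,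
      (forall s t, 0 <= s -> s <= t -> ((X s w).1 <= (X t w).1)%N) /\
      cadlag setT (fun t => (X t w).1)}) /\
  hunt_process D F (fun x => P (0%N, x)) (fun t w => (X t w).2)
    (K alpha D p mu).
Proof.
case: p_heat_kernel => p_ge0 p_cont _; split.
  by move=> z Dz; exact: (level_nondecreasing_cadlag X_hunt Dz).
exact: hunt_process_snd.
Qed.
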